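(* Let $M_1=(E_1,\mathcal B_1),\dots,M_k=(E_k,\mathcal B_k)$ be matroids, $\mathbb M=(M_1,\dots,M_k)$, and let $K$ be the set of coloops of the matroid union $\bigvee_{i=1}^k M_i$. For feasible basis sequences $\mathbb B=(B_1,\dots,B_k)$ and $\mathbb B'=(B'_1,\dots,B'_k)$ of $\mathbb M$, $\mathbb B$ is reconfigurable to $\mathbb B'$ if and only if $(K\cap B_1,\dots,K\cap B_k)=(K\cap B'_1,\dots,K\cap B'_k)$.
   Context: A matroid $M=(E,\mathcal B)$ is a finite set with a nonempty family of bases satisfying the basis exchange axiom. The ground sets $E_i$ may intersect. The matroid union $\bigvee_{i=1}^k M_i$ is the matroid on $\bigcup_i E_i$ whose bases are the inclusion-maximal sets among $\{B_1\cup\dots\cup B_k : B_i\in\mathcal B_i\}$. A coloop of a matroid is an element belonging to every basis. A basis sequence of $\mathbb M$ is $(B_1,\dots,B_k)$ with $B_i\in\mathcal B_i$; it is feasible if the $B_i$ are pairwise disjoint. Two feasible basis sequences are adjacent if there is $i$ with $B_j=B'_j$ for $j\ne i$ and $B'_i=B_i-x+y$ for some $x\in B_i$, $y\in E_i\setminus B_i$. $\mathbb B$ is reconfigurable to $\mathbb B'$ if there is a sequence of feasible basis sequences from $\mathbb B$ to $\mathbb B'$ with consecutive ones adjacent. *)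

(* Defs.v *)
From mathcomp Require Import all_boot.

Set Implicit Arguments.
Unset Strict Implicit.
Unset Printing Implicit Defensive.

(* The finite type T is an ambient universe; each matroid has its own ground  *)
(* set inside it, so that the ground sets of several matroids may overlap.    *)
Record matroid (T : finType) := Matroid {
  ground : {set T};
  bases : {set {set T}};
  bases_ground : forall B, B \in bases -> B \subset ground;
  bases_neq0 : bases != set0;
  bases_exchange : forall B1 B2 x, B1 \in bases -> B2 \in bases ->
    x \in B1 :\: B2 ->
    exists2 y, y \in B2 :\: B1 & y |: (B1 :\ x) \in bases
}.

Definition coloops (T : finType) (M : matroid T) : {set T} :=
  [set x in ground M | [forall B in bases M, x \in B]].

Section BasisTheory.
Variables (T : finType) (M : matroid T).
Implicit Types I J B C : {set T}.

Lemma card_exchange_setD B C x y :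
  x \in B -> x \notin C -> y \in C -> #|(y |: (B :\ x)) :\: C| < #|B :\: C|.
Proof.
move=> xB xC yC; apply: proper_card; apply/properP; split; last first.
  exists x; first by rewrite inE xC.
  by rewrite !inE xC eqxx orbF; apply: contraNneq xC => ->.
apply/subsetP => z; rewrite !inE => /andP[zC /orP[/eqP zy|/andP[_ ->]]].
  by rewrite zy yC in zC.
by rewrite zC.
Qed.

Lemma card_bases B1 B2 : B1 \in bases M -> B2 \in bases M -> #|B1| = #|B2|.
Proof.
have [n] := ubnP #|B1 :\: B2|; elim: n B1 => // n IHn B1 le_n B1M B2M.
have [sB12|/subsetPn[x xB1 xB2]] := boolP (B1 \subset B2).
  suff -> : B1 = B2 by [].
  apply/eqP; rewrite eqEsubset sB12 /=; apply/subsetP => z zB2.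
  apply: contraT => zB1.
  have [|y] := bases_exchange B2M B1M (x := z); first by rewrite inE zB1.
  by rewrite inE => /andP[/negP yB2 /(subsetP sB12)].
have xD : x \in B1 :\: B2 by rewrite inE xB2.
have [y] := bases_exchange B1M B2M xD.
rewrite inE => /andP[yB1 yB2] B3M.
have <- : #|y |: (B1 :\ x)| = #|B1|.
  by rewrite cardsU1 !inE (negPf yB1) andbF [RHS](cardsD1 x) xB1.
by apply: IHn => //; apply: leq_trans (card_exchange_setD _ _ _) _.
Qed.

Lemma bases_augment I J B1 B2 :
    B1 \in bases M -> B2 \in bases M -> I \subset B1 -> J \subset B2 ->
    #|I| < #|J| ->
  exists2 x, x \in J :\: I & exists2 B, B \in bases M & x |: I \subset B.
Proof.
move=> B1M B2M sIB1 sJB2 ltIJ.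
have [n] := ubnP #|B1 :\: (I :|: B2)|.
elim: n B1 B1M sIB1 => // n IHn B1 B1M sIB1 le_n.
have [sB1|/subsetPn[x]] := boolP (B1 :\: B2 \subset I); last first.
  rewrite inE => /andP[xB2 xB1] xI.
  have xD : x \in B1 :\: B2 by rewrite inE xB2.
  have [y] := bases_exchange B1M B2M xD.
  rewrite inE => /andP[yB1 yB2] B3M.
  apply: (IHn _ B3M).
    apply/subsetP => z zI; rewrite !inE (subsetP sIB1 _ zI) andbT.
    by case: (z =P x) zI xI => [->->|]; rewrite ?orbT.
  apply: leq_trans (card_exchange_setD _ _ _) _ => //.
    by rewrite inE negb_or xI.
  by rewrite inE yB2 orbT.
have [/subsetP sJ|/subsetPn[x]] := boolP (J :&: B1 \subset I); last first.
  rewrite inE => /andP[xJ xB1] xI; exists x; first by rewrite inE xI.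
  by exists B1 => //; rewrite subUset sub1set xB1.
have s1 : B1 :\: B2 \subset I :\: J.
  apply/subsetP => z zD; rewrite inE (subsetP sB1 _ zD) andbT.
  by move: zD; rewrite inE => /andP[zB2 _]; apply: contra zB2 => /(subsetP sJB2).
have s2 : J :\: I \subset B2 :\: B1.
  apply/subsetP => z; rewrite !inE => /andP[zI zJ].
  rewrite (subsetP sJB2 _ zJ) andbT; apply: contra zI => zB1.
  by apply: sJ; rewrite inE zJ.
have eqD : #|B1 :\: B2| = #|B2 :\: B1|.
  by apply/eqP; rewrite -(eqn_add2l #|B1 :&: B2|) cardsID setIC cardsID;
     apply/eqP/card_bases.
have ltD : #|I :\: J| < #|J :\: I|.
  by rewrite -(ltn_add2l #|I :&: J|) cardsID setIC cardsID.
have := leq_ltn_trans (subset_leq_card s1) (leq_trans ltD (subset_leq_card s2)).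
by rewrite eqD ltnn.
Qed.

End BasisTheory.

Section MatroidUnion.
Variables (T : finType) (k : nat) (M : 'I_k -> matroid T).

Definition basis_union (X : {set T}) : bool :=
  [exists B : {ffun 'I_k -> {set T}},
    [forall i, B i \in bases (M i)] && (X == \bigcup_i B i)].

Definition union_ground : {set T} := \bigcup_i ground (M i).

Definition union_bases : {set {set T}} := [set X | maxset basis_union X].

(* The matroid axioms for the union: a set is independent in it iff its       *)
(* elements can be coloured by indices so that each class c^-1(i) is          *)
(* independent in M i.                                                        *)
Local Notation coloring := {ffun T -> option 'I_k}.
Implicit Types c d : coloring.

Definition csupp c : {set T} := [set x | c x != None].
Definition cclass c i : {set T} := [set x | c x == Some i].
Definition cindep c := forall i, exists2 B, B \in bases (M i) & cclass c i \subset B.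
Definition cset c x o : coloring := [ffun z => if z == x then o else c z].

Lemma card_csupp c : #|csupp c| = \sum_i #|cclass c i|.
Proof.
rewrite -sum1_card; under [RHS]eq_bigr do rewrite -sum1_card.
rewrite (exchange_big_dep (mem (csupp c))) /= => [|i x _]; last first.
  by rewrite !inE => /eqP->.
apply: eq_bigr => x; rewrite inE; case cx: (c x) => [i|] // _.
by rewrite (big_pred1 i) // => j; rewrite inE cx eq_sym; apply/eqP/eqP => [[]|->].
Qed.

Lemma csupp_set c x i : csupp (cset c x (Some i)) = x |: csupp c.
Proof. by apply/setP => z; rewrite !inE ffunE; case: (z =P x). Qed.

Lemma cclass_set c x i : cclass (cset c x (Some i)) i = x |: cclass c i.
Proof. by apply/setP => z; rewrite !inE ffunE; case: (z =P x); rewrite ?eqxx. Qed.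

Lemma cclass_set_sub c x o j : o != Some j -> cclass (cset c x o) j \subset cclass c j.
Proof.
by move=> oj; apply/subsetP => z; rewrite !inE ffunE; case: (z =P x); rewrite ?(negPf oj).
Qed.

Lemma cindep_sub c x o : cindep c ->
  (forall i, o = Some i -> exists2 B, B \in bases (M i) & x |: cclass c i \subset B) ->
  cindep (cset c x o).
Proof.
move=> cI oI i; have [oi|oi] := eqVneq o (Some i).
  by have [B BM sB] := oI i oi; exists B => //; rewrite oi cclass_set.
have [B BM sB] := cI i; exists B => //.
exact: subset_trans (cclass_set_sub _ _ oi) sB.
Qed.

Lemma cindep_augment c d : cindep c -> cindep d -> #|csupp c| < #|csupp d| ->
  exists2 x, x \in csupp d :\: csupp c &
    exists2 c', cindep c' & csupp c' = x |: csupp c.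
Proof.
move=> + dI; have [n] := ubnP #|[set x | c x != d x]|.
elim: n c => // n IHn c le_n cI ltcd.
have [i lti] : exists i, #|cclass c i| < #|cclass d i|.
  apply/existsP; apply: contraTT ltcd; rewrite negb_exists => /forallP le.
  by rewrite -leqNgt !card_csupp; apply: leq_sum => i _; rewrite leqNgt le.
have [B1 B1M s1] := cI i; have [B2 B2M s2] := dI i.
have [x] := bases_augment B1M B2M s1 s2 lti.
rewrite !inE => /andP[cxi /eqP dxi] xI.
have c'I : cindep (cset c x (Some i)).
  by apply: cindep_sub => // j [<-].
have [xc|xc] := boolP (x \in csupp c); last first.
  exists x; first by rewrite inE xc inE dxi.
  by exists (cset c x (Some i)); rewrite ?csupp_set.
have eqs : csupp (cset c x (Some i)) = csupp c.
  by rewrite csupp_set; apply/setUidPr; rewrite sub1set.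
rewrite -eqs; apply: IHn; rewrite ?eqs //.
rewrite ltnS in le_n; apply: leq_trans le_n; apply: proper_card.
apply/properP; split.
  by apply/subsetP => z; rewrite !inE ffunE; case: (z =P x) => // ->; rewrite dxi eqxx.
by exists x; rewrite !inE ?ffunE ?eqxx dxi ?eqxx.
Qed.

Lemma basis_union_coloring X : basis_union X -> exists2 c, cindep c & csupp c = X.
Proof.
case/existsP => B /andP[/forallP BM /eqP ->].
exists [ffun x => [pick i | x \in B i]].
  move=> i; exists (B i) => //; apply/subsetP => x; rewrite inE ffunE.
  by case: pickP => // j xj /eqP[<-].
apply/setP => x; rewrite inE ffunE; case: pickP => [i xi|xN].
  by apply/esym/bigcupP; exists i.
by apply/esym/negP => /bigcupP[i _]; rewrite xN.
Qed.

Lemma coloring_basis_union c : cindep c -> exists2 X, basis_union X & csupp c \subset X.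
Proof.
move=> cI.
pose B : {ffun 'I_k -> {set T}} :=
  [ffun i => odflt set0 [pick B in bases (M i) | cclass c i \subset B]].
have BP i : B i \in bases (M i) /\ cclass c i \subset B i.
  rewrite ffunE; case: pickP => [b /andP[] //|no].
  by have [b bM sb] := cI i; have := no b; rewrite bM sb.
exists (\bigcup_i B i).
  by apply/existsP; exists B; rewrite eqxx andbT; apply/forallP => i; case: (BP i).
apply/subsetP => x; rewrite inE; case cx: (c x) => [i|] // _.
apply/bigcupP; exists i => //; apply: (subsetP (proj2 (BP i))).
by rewrite inE cx.
Qed.

Lemma coloring_max c : cindep c ->
  exists2 X, X \in union_bases & csupp c \subset X.
Proof.
move=> /coloring_basis_union[X /maxset_exists[Y Ymax sXY] sX].
by exists Y; rewrite ?inE //; apply: subset_trans sXY.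
Qed.

Lemma union_bases_coloring X : X \in union_bases ->
  exists2 c, cindep c & csupp c = X.
Proof. by rewrite inE => /maxsetp/basis_union_coloring. Qed.

Lemma union_bases_le X1 X2 :
  X1 \in union_bases -> X2 \in union_bases -> #|X2| <= #|X1|.
Proof.
move=> X1M X2M; rewrite leqNgt; apply/negP => lt12.
have [c cI cX] := union_bases_coloring X1M.
have [d dI dX] := union_bases_coloring X2M.
have [|x] := cindep_augment cI dI; first by rewrite cX dX.
rewrite cX dX => xD [c' /coloring_basis_union[Y YP sY] c'X].
move: sY; rewrite c'X subUset sub1set => /andP[xY sY].
move: X1M; rewrite inE => /maxsetP[_ /(_ Y YP sY) YX].
by move: xD; rewrite inE -YX xY.
Qed.

Lemma union_bases_ground X : X \in union_bases -> X \subset union_ground.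
Proof.
rewrite inE => /maxsetp/existsP[B /andP[/forallP BM /eqP->]].
by apply/bigcupsP => i _; apply: (bigcup_max i) => //; apply: bases_ground.
Qed.

Lemma union_bases_neq0 : union_bases != set0.
Proof.
have [|X XM _] := @coloring_max [ffun=> None].
  move=> i; have /set0Pn[B BM] := bases_neq0 (M i); exists B => //.
  by apply/subsetP => x; rewrite inE ffunE.
by apply/set0Pn; exists X.
Qed.

Lemma union_bases_exchange X1 X2 x :
    X1 \in union_bases -> X2 \in union_bases -> x \in X1 :\: X2 ->
  exists2 y, y \in X2 :\: X1 & y |: (X1 :\ x) \in union_bases.
Proof.
move=> X1M X2M; rewrite inE => /andP[xX2 xX1].
have [c cI cX] := union_bases_coloring X1M.
have [d dI dX] := union_bases_coloring X2M.
have c0I : cindep (cset c x None) by apply: cindep_sub.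
have c0X : csupp (cset c x None) = X1 :\ x.
  by rewrite -cX; apply/setP => z; rewrite !inE ffunE; case: (z =P x).
have [|y] := cindep_augment c0I dI.
  by rewrite c0X dX (leq_trans _ (union_bases_le X2M X1M)) // (cardsD1 x X1) xX1.
rewrite c0X dX !inE negb_and negbK => /andP[/orP yD yX2] [c' c'I c'X].
have yX1 : y \notin X1.
  by case: yD => // /eqP yx; rewrite -yx yX2 in xX2.
exists y; first by rewrite inE yX1.
have [Y YM sY] := coloring_max c'I; rewrite c'X in sY.
suff /eqP-> : y |: (X1 :\ x) == Y by [].
rewrite eqEcard sY (leq_trans (union_bases_le X1M YM)) //.
by rewrite cardsU1 !inE (negPf yX1) andbF (cardsD1 x X1) xX1.
Qed.

Definition matroid_union : matroid T :=
  Matroid union_bases_ground union_bases_neq0 union_bases_exchange.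

End MatroidUnion.

Section Reconfiguration.
Variables (T : finType) (k : nat) (M : 'I_k -> matroid T).
Implicit Types B C : {ffun 'I_k -> {set T}}.

Definition basis_sequence B : bool := [forall i, B i \in bases (M i)].

Definition feasible B : bool :=
  basis_sequence B && [forall i, forall j, (i != j) ==> [disjoint B i & B j]].

Definition adjacent B C : bool :=
  [&& feasible B, feasible C &
    [exists i, [forall j, (j != i) ==> (B j == C j)] &&
      [exists x in B i, exists y in ground (M i) :\: B i,
        C i == y |: (B i :\ x)]]].

(* The intermediate sequences are feasible by the definition of adjacent.     *)
Definition reconfigurable B C : Prop :=
  feasible B /\ exists2 p, path adjacent B p & C = last B p.

End Reconfiguration.

(* Main.v *)
(* Exchanges do not change the union of a feasible sequence inside K, since   *)
(* that union is always a basis of the matroid union; this gives "only if".   *)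
(* For "if", write y -> x when B_i - x + y is a basis of M_i for some i with  *)
(* x in B_i. The elements reachable from the uncovered ones are exactly the   *)
(* uncovered ones and the non-coloops in the union of the B_i. If B' covers   *)
(* some s missed by B, one exchange inserting s brings B closer to B'.        *)
(* Otherwise the exchanges of B_i towards B'_i contain a cycle, and in a      *)
(* shortest one all exchanges can be made simultaneously, which again brings  *)
(* B closer to B'. To realise this rotation by single moves, follow a         *)
(* shortest path from an uncovered element to the cycle until its last step:  *)
(* the free place then goes once around the cycle and back along the path.    *)
Require Import Defs.
From mathcomp Require Import all_boot.
From mathcomp Require Import perm.

Set Implicit Arguments.
Unset Strict Implicit.
Unset Printing Implicit Defensive.

(** Only if: the union of a feasible sequence is a basis of the matroid union
    ([union_bases_sequence]), so it contains K, and a move neither inserts nor removes an element of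
    K ([adjacent_coloops]).

    If: descent on the number of misplaced elements ([seq_dist]). An uncovered element wanted by the
    target moves in directly ([closer_of_uncovered]). Otherwise misplaced elements block one
    another, which yields a cycle of wanted exchanges ([serial_cycle]); a shortest one is chordless
    ([induced_cycle]), so rotating it is feasible ([feasible_rotate]). A displaced element of the
    cycle is no coloop, so a free element reaches it ([reach_noncoloop]), and [rotate_connect]
    splits the rotation into moves.

    Combined exchanges stay under control because [exch] is the support of the fundamental-circuit
    matrix of a basis and an exchange is a pivot: a pivot on (y, x) preserves whether another entry
    (w, z) vanishes if (y, z) or (w, x) is zero ([exch_in], [exch_out]). *)

(** * Single and simultaneous exchanges in one basis *)

Section Exchange.
Variables (T : finType) (M : matroid T).
Implicit Types (B D I W : {set T}) (w x y z : T).

Definition exch B w z := [&& w \notin B, z \in B & w |: (B :\ z) \in bases M].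

Lemma bases_sub_eq B D : B \in bases M -> D \in bases M -> B \subset D -> B = D.
Proof.
by move=> BM DM sBD; apply/eqP; rewrite eqEcard sBD (card_bases BM DM) leqnn.
Qed.

Lemma bases_extend I B D : B \in bases M -> D \in bases M -> I \subset D ->
  exists D', [/\ D' \in bases M, I \subset D' & D' \subset I :|: B].
Proof.
move=> BM; have [n] := ubnP #|D :\: (I :|: B)|.
elim: n D => // n IHn D le_n DM sID.
have [sD|/subsetPn[x xD]] := boolP (D \subset I :|: B); first by exists D.
rewrite inE negb_or => /andP[xI xB].
have [|y] := bases_exchange DM BM (x := x); first by rewrite inE xB.
rewrite inE => /andP[yD yB] D1M; apply: (IHn _ _ D1M).
  apply: leq_trans (card_exchange_setD _ _ _) _ => //.
    by rewrite inE negb_or xI.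
  by rewrite inE yB orbT.
apply/subsetP => z zI; rewrite !inE (subsetP sID _ zI) andbT.
by case: (z =P x) zI xI => [->->|]; rewrite ?orbT.
Qed.

(** The fundamental circuit of [w] in [B] cannot lie inside the independent set [w |: I]; [z] is one
    of its elements outside. *)
Lemma exch_avoid B D I w : B \in bases M -> D \in bases M -> w \notin B ->
  I \subset B -> w |: I \subset D -> exists2 z, z \in B :\: I & exch B w z.
Proof.
move=> BM DM wB sIB sD.
have [D' [D'M sID' sD']] := bases_extend BM DM sD.
have wD' : w \in D' by rewrite (subsetP sID') ?setU11.
have [sBD'|/subsetPn[z zB zD']] := boolP (B \subset D').
  by rewrite (bases_sub_eq BM D'M sBD') wD' in wB.
exists z.
  rewrite inE zB andbT; apply: contra zD' => zI.
  by rewrite (subsetP sID') // inE zI orbT.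
rewrite /exch wB zB /=; suff <- : D' = w |: (B :\ z) by [].
apply/eqP; rewrite eqEcard (card_bases D'M BM); apply/andP; split.
  apply/subsetP => u uD'; move: (subsetP sD' _ uD'); rewrite !inE.
  have -> : u != z by apply: contraNneq zD' => <-.
  by case: (u == w) => //= /orP[/(subsetP sIB)|].
by rewrite cardsU1 !inE (negPf wB) andbF /= (cardsD1 z B) zB.
Qed.

Lemma exch_back B x y : exch B y x -> x |: ((y |: (B :\ x)) :\ y) = B.
Proof.
case/and3P => yB xB _; apply/setP => u; rewrite !inE.
case: (u =P x) => [->|_]; first by rewrite xB.
by case: (u =P y) => [->|_] //=; rewrite (negPf yB).
Qed.

Lemma exch_sym B x y : B \in bases M -> exch B y x -> exch (y |: (B :\ x)) x y.
Proof.
move=> BM e; rewrite /exch exch_back // BM setU11 !andbT !inE eqxx /= orbF.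
by case/and3P: e => yB xB _; apply: contraNneq yB => <-.
Qed.

Lemma setU1D1_swap B x y z : x \in B -> z != x -> z != y ->
  x |: ((y |: (B :\ x)) :\ z) = y |: (B :\ z).
Proof.
move=> xB zx zy; apply/setP => u; rewrite !inE.
case: (u =P x) => [->|_]; first by rewrite (eq_sym x z) zx xB orbT.
by case: (u =P y) => [->|_] //=; rewrite (eq_sym y z) zy.
Qed.

(** Augmenting the new basis without [z] from [w |: (B :\ z)] adds either [w], as wanted, or [x],
    and then [y] could have replaced [z] in [B]. *)
Let exch_in_sub B x y z w : B \in bases M -> exch B y x -> z != x -> z != y ->
  ~~ exch B y z -> exch B w z -> exch (y |: (B :\ x)) w z.
Proof.
move=> BM e zx zy nyz /and3P[wB zB DM].
have [yB xB B1M] := and3P e.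
have wy : w != y by apply: contraNneq nyz => <-; rewrite /exch wB zB.
rewrite /exch !inE negb_or wy negb_and wB orbT zx zB orbT /=.
set B1 := y |: _ in B1M *.
have zB1 : z \in B1 by rewrite !inE zx zB orbT.
have cI : #|B1| = #|B1 :\ z|.+1 by rewrite (cardsD1 z) zB1.
have [||u] := bases_augment (I := B1 :\ z) B1M DM _ (subxx _).
- exact: subD1set.
- by rewrite (card_bases DM B1M) cI.
move=> uD [D' D'M sD'].
have D'E : u |: (B1 :\ z) = D'.
  apply/eqP; rewrite eqEcard sD' (card_bases D'M B1M) cI cardsU1.
  by case/setDP: uD => _ ->; rewrite add1n ltnSn.
rewrite -D'E in D'M.
have [uw|uw] := eqVneq u w; first by rewrite -uw.
suff ux : u = x.
  by case/negP: nyz; rewrite /exch yB zB /= -(setU1D1_swap xB zx zy) -[X in X |: _]ux.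
move: uD; rewrite !inE (negPf uw) /=; case: (u =P z) => //= _.
move=> /andP[]; rewrite negb_or negb_and negbK.
by case/andP => _ /orP[/eqP //|/negPf->].
Qed.

Lemma exch_in B x y z w : B \in bases M -> exch B y x -> z != x -> z != y ->
  ~~ exch B y z -> exch (y |: (B :\ x)) w z = exch B w z.
Proof.
move=> BM e zx zy nyz; apply/idP/idP; last exact: exch_in_sub.
have e' := exch_sym BM e; have [yB xB B1M] := and3P e.
move=> /(exch_in_sub B1M e' zy zx); rewrite exch_back //; apply.
apply: contra nyz => /and3P[_]; rewrite /exch yB !inE (negPf zy) zx /= => ->.
by rewrite setU1D1_swap.
Qed.

(** Exchanging [x] out of [w |: (B :\ z)] towards the new basis brings in either [y], as wanted, or
    [z], and then [w] could have replaced [x] in [B]. *)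
Let exch_out_sub B x y z w : B \in bases M -> exch B y x -> w != y ->
  ~~ exch B w x -> exch B w z -> exch (y |: (B :\ x)) w z.
Proof.
move=> BM e wy nwx ewz; have [wB zB DM] := and3P ewz.
have [yB xB B1M] := and3P e.
have zx : z != x by apply: contraNneq nwx => <-.
have xw : x != w by apply: contraNneq wB => <-.
have xy : x != y by apply: contraNneq yB => <-.
have zy : z != y by apply: contraNneq yB => <-.
rewrite /exch !inE negb_or wy negb_and wB orbT zx zB orbT /=.
have [|u] := bases_exchange DM B1M (x := x).
  by rewrite !inE eqxx (negPf xy) (negPf xw) eq_sym zx xB.
rewrite !inE negb_or negb_and negbK => /andP[/andP[uw uzB] uyB] D'M.
have [uy|uy] := eqVneq u y.
  suff <- : u |: ((w |: (B :\ z)) :\ x) = w |: ((y |: (B :\ x)) :\ z) by [].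
  rewrite uy; apply/setP => v; rewrite !inE.
  case: (v =P w) => [->|_]; first by rewrite (eq_sym w x) xw orbT.
  case: (v =P y) => [->|_]; first by rewrite (eq_sym y z) zy.
  by rewrite /= andbCA.
have uz : u = z.
  by move: uzB uyB; rewrite (negPf uy) /=; case/orP=> [/eqP //|/negPf->]; rewrite andbF.
case/negP: nwx; rewrite /exch wB xB /=.
suff -> : w |: (B :\ x) = u |: ((w |: (B :\ z)) :\ x) by [].
rewrite uz; apply/setP => v; rewrite !inE.
case: (v =P w) => [->|_]; first by rewrite (eq_sym w x) xw orbT.
by case: (v =P z) => [->|_] //=; rewrite zx zB.
Qed.

Lemma exch_out B x y z w : B \in bases M -> exch B y x -> w != y -> w != x ->
  ~~ exch B w x -> exch (y |: (B :\ x)) w z = exch B w z.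
Proof.
move=> BM e wy wx nwx; apply/idP/idP; last exact: exch_out_sub.
have e' := exch_sym BM e; have [yB xB B1M] := and3P e.
move=> /(exch_out_sub B1M e' wx); rewrite exch_back //; apply.
apply: contra nwx => /and3P[wB1 _]; rewrite setU1K; last first.
  by rewrite !inE (negPf yB) andbF.
rewrite /exch xB => ->; rewrite !andbT.
by move: wB1; rewrite !inE wx negb_or => /andP[].
Qed.

(** The exchange pattern between [W] and its image is diagonal, so by [exch_in] performing one
    exchange leaves the pattern of the others intact. *)
Lemma bases_multi_exch B W (f : T -> T) : B \in bases M -> {in W &, injective f} ->
  (forall w, w \in W -> exch B w (f w)) ->
  {in W &, forall w w', w' != w -> ~~ exch B w (f w')} ->
  (B :\: f @: W) :|: W \in bases M.
Proof.
have [n] := ubnP #|W|; elim: n B W => // n IHn B W le_n BM fI eW neW.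
have [->|[w wW]] := set_0Vmem W; first by rewrite imset0 setD0 setU0.
have [wB fwB B1M] := and3P (eW w wW).
set B1 := w |: _ in B1M.
have WP u : u \in W :\ w -> u != w /\ u \in W by rewrite !inE => /andP.
have fWB u : u \in W -> f u \in B by move=> /eW/and3P[].
have fWw u : u \in W -> f u != w by move=> /fWB; apply: contraTneq => ->.
have inE1 u v : u \in W :\ w -> exch B1 v (f u) = exch B v (f u).
  move=> /WP[uw uW]; apply: exch_in => //; [exact: eW| |exact: fWw|exact: neW].
  by apply: contraNneq uw => /fI->.
suff <- : (B1 :\: f @: (W :\ w)) :|: (W :\ w) = (B :\: f @: W) :|: W.
  apply: IHn => //.
  - by rewrite (cardsD1 w W) wW in le_n.
  - by move=> u v /WP[_ uW] /WP[_ vW]; apply: fI.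
  - by move=> u uW; rewrite inE1 //; apply: eW; case: (WP _ uW).
  - move=> u v uW vW vu; rewrite inE1 //.
    by case: (WP _ uW); case: (WP _ vW) => *; apply: neW.
have WE : W = w |: (W :\ w) by rewrite setD1K.
rewrite [in RHS]WE imsetU1; apply/setP => z; rewrite !inE.
have [->|zw] := eqVneq z w; last first.
  by rewrite /= negb_or; do 3?[case: (_ \in _)]; case: (z == f w).
rewrite /= orbT orbF andbT; apply/negP => /imsetP[u /WP[_ uW] wfu].
by case/eqP: (fWw _ uW).
Qed.

End Exchange.

(** * Feasible sequences and single moves *)

Section Sequences.
Variables (T : finType) (k : nat) (M : 'I_k -> matroid T).
Implicit Types (B C : {ffun 'I_k -> {set T}}) (c p : seq T) (s u v w x y z : T).

Definition covered B z := [exists i, z \in B i].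
(** In a feasible sequence [x] lies in at most one set and merely names it: [y] could replace [z] in
    the set that contains [x]. *)
Definition clash B y x z := [exists i, (x \in B i) && exch (M i) (B i) y z].
Definition darc B : rel T := fun y x => clash B y x x.
(* For [y] uncovered and [x] in [B i], [act (tperm y x) B] replaces [x] by [y] *)
(* in [B i] and leaves the other sets unchanged.                              *)
Definition act (f : T -> T) B : {ffun 'I_k -> {set T}} := [ffun i => f @^-1: B i].

Lemma coveredP B z : reflect (exists i, z \in B i) (covered B z).
Proof. exact: existsP. Qed.

Lemma clashP B y x z :
  reflect (exists2 i, x \in B i & exch (M i) (B i) y z) (clash B y x z).
Proof.
by apply: (iffP existsP) => [[i /andP[]]|[i xi e]]; exists i => //; rewrite xi.
Qed.

Lemma darcP B y x : reflect (exists i, exch (M i) (B i) y x) (darc B y x).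
Proof.
apply: (iffP (clashP B y x x)) => [[i _]|[i e]]; exists i => //.
by case/and3P: e.
Qed.

Lemma clash_darc B y x z : clash B y x z -> darc B y z.
Proof. by case/clashP => i _ e; apply/darcP; exists i. Qed.

Lemma darc_covered B y x : darc B y x -> covered B x.
Proof. by case/darcP => i /and3P[_ xi _]; apply/coveredP; exists i. Qed.

Lemma act_comp f g B : act f (act g B) = act (g \o f) B.
Proof. by apply/ffunP => i; apply/setP => z; rewrite !ffunE !inE. Qed.

Lemma eq_act f g B : f =1 g -> act f B = act g B.
Proof. by move=> fg; apply/ffunP => i; apply/setP => z; rewrite !ffunE !inE fg. Qed.

Lemma act_id f B : f =1 id -> act f B = B.
Proof. by move=> fg; apply/ffunP => i; apply/setP => z; rewrite !ffunE !inE fg. Qed.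

Lemma feasibleP B : reflect
  ((forall i, B i \in bases (M i)) /\ (forall i j z, z \in B i -> z \in B j -> i = j))
  (feasible M B).
Proof.
apply: (iffP andP) => [[/forallP BM /forallP dB]|[BM dB]]; split => //.
- move=> i j z zi zj; apply/eqP; apply: contraTT zj => ij.
  by move/forallP/(_ j): (dB i); rewrite ij => /disjointFr->.
- exact/forallP.
- apply/forallP => i; apply/forallP => j; apply/implyP => ij.
  rewrite disjoint_subset; apply/subsetP => z zi; rewrite inE.
  by apply: contra ij => zj; apply/eqP/(dB _ _ _ zi).
Qed.

Lemma feasible_act f B : feasible M B ->
  (forall i, f @^-1: B i \in bases (M i)) -> feasible M (act f B).
Proof.
case/feasibleP => _ dB fM; apply/feasibleP; split=> [i|i j z].
  by rewrite ffunE.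
by rewrite !ffunE !inE; apply: dB.
Qed.

Lemma act_tperm_exch B y x i : feasible M B -> ~~ covered B y -> x \in B i ->
  act (tperm y x) B i = y |: (B i :\ x).
Proof.
move=> /feasibleP[_ dB] yB xi; rewrite ffunE; apply/setP => z; rewrite !inE.
have [->|/eqP zy] := z =P y; first by rewrite tpermL.
have [->|/eqP zx] := z =P x; last by rewrite tpermD // eq_sym.
by rewrite tpermR; apply/negP => yi; case/negP: yB; apply/coveredP; exists i.
Qed.

Lemma act_tperm_other B y x i j : feasible M B -> ~~ covered B y -> x \in B i ->
  j != i -> act (tperm y x) B j = B j.
Proof.
move=> /feasibleP[_ dB] yB xi ji; rewrite ffunE; apply/setP => z; rewrite !inE.
have yj : y \in B j = false.
  by apply/negP => yj; case/negP: yB; apply/coveredP; exists j.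
have xj : x \in B j = false by apply: contraNF ji => xj; apply/eqP/(dB _ _ _ xj).
by case: tpermP => [->|->|]; rewrite ?xj ?yj.
Qed.

Lemma feasible_move B y x : feasible M B -> ~~ covered B y -> darc B y x ->
  feasible M (act (tperm y x) B).
Proof.
move=> fB yB /darcP[i e]; have /and3P[yi xi BM'] := e.
apply: feasible_act => // j; have := act_tperm_exch fB yB xi.
have [->|ji] := eqVneq j i; first by rewrite ffunE => ->.
have := act_tperm_other fB yB xi ji; rewrite ffunE => -> _.
by case/feasibleP: fB.
Qed.

Lemma adjacent_act B y x : feasible M B -> feasible M (act (tperm y x) B) ->
  ~~ covered B y -> covered B x -> adjacent M B (act (tperm y x) B).
Proof.
move=> fB fC yB /coveredP[i xi]; rewrite /adjacent fB fC /=.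
have Ci := act_tperm_exch fB yB xi.
apply/existsP; exists i; apply/andP; split.
  by apply/forallP => j; apply/implyP => ji; rewrite (act_tperm_other fB yB xi ji).
apply/exists_inP; exists x => //; apply/exists_inP; exists y; last exact/eqP.
rewrite inE; apply/andP; split.
  by apply: contra yB => yi; apply/coveredP; exists i.
have /feasibleP[/(_ i) CM _] := fC; apply: (subsetP (bases_ground CM)).
by rewrite Ci setU11.
Qed.

Lemma adjacent_move B y x : feasible M B -> ~~ covered B y -> darc B y x ->
  adjacent M B (act (tperm y x) B).
Proof.
move=> fB yB e; apply: adjacent_act => //; [exact: feasible_move|exact: darc_covered e].
Qed.

Lemma uncovered_move B y x : feasible M B -> ~~ covered B y ->
  ~~ covered (act (tperm y x) B) x.
Proof.
move=> fB yB; apply: contra yB => /coveredP[i].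
by rewrite ffunE inE tpermR => yi; apply/coveredP; exists i.
Qed.

Lemma mem_move B y x v i : v != y -> v != x ->
  (v \in act (tperm y x) B i) = (v \in B i).
Proof. by move=> vy vx; rewrite ffunE inE tpermD // eq_sym. Qed.

Lemma clash_move_in B y x w v z : feasible M B -> ~~ covered B y -> darc B y x ->
  v != y -> v != x -> z != y -> z != x -> ~~ clash B y x z ->
  clash (act (tperm y x) B) w v z = clash B w v z.
Proof.
move=> fB yB /darcP[i e] vy vx zy zx nyz.
apply: eq_existsb => j; rewrite mem_move //; congr (_ && _).
have /and3P[_ xi _] := e; have [->|ji] := eqVneq j i.
  rewrite (act_tperm_exch fB yB xi) exch_in //; first by case/feasibleP: fB.
  by apply: contra nyz => e'; apply/clashP; exists i.
by rewrite (act_tperm_other fB yB xi ji).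
Qed.

Lemma clash_move_out B y x w v z : feasible M B -> ~~ covered B y -> darc B y x ->
  v != y -> v != x -> w != y -> darc B w v -> ~~ clash B w v x ->
  clash (act (tperm y x) B) w v z = clash B w v z.
Proof.
move=> fB yB /darcP[i e] vy vx wy /darcP[l ewv] nwx.
apply: eq_existsb => j; rewrite mem_move //.
have [vj|//] := boolP (v \in B j); rewrite /=.
have [BM dB] := feasibleP _ fB.
have jl : j = l by apply: (dB _ _ _ vj); case/and3P: ewv.
rewrite -jl in ewv; have /and3P[wj _ _] := ewv.
have /and3P[_ xi _] := e; have [ji|ji] := eqVneq j i; last first.
  by rewrite (act_tperm_other fB yB xi ji).
rewrite ji in vj wj *; rewrite (act_tperm_exch fB yB xi) exch_out //.
  by apply: contraNneq wj => ->.
by apply: contra nwx => e'; apply/clashP; exists i.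
Qed.

Lemma darc_move_back B y x w : feasible M B -> ~~ covered B y -> w != y ->
  darc B w x -> darc (act (tperm y x) B) w y.
Proof.
move=> fB yB wy /darcP[i /and3P[wi xi BM']]; apply/darcP; exists i.
rewrite (act_tperm_exch fB yB xi) /exch setU11 setU1K; last first.
  by apply: contra yB; rewrite !inE => /andP[_ yi]; apply/coveredP; exists i.
by rewrite BM' !inE (negPf wy) (negPf wi) andbF.
Qed.

(* Moving [y] to its successor shifts every element of the path by one place, *)
(* so the absence of chords must only be checked within a single basis, which *)
(* is what [clash] records.                                                   *)
Fixpoint geodesic B y p := if p is x :: p' then
  [&& darc B y x, all (fun z => ~~ clash B y x z) p' & geodesic B x p'] else true.

Lemma geodesic_eq B C u p :
  (forall w v z, v \in p -> z \in p -> clash B w v z = clash C w v z) ->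
  geodesic B u p = geodesic C u p.
Proof.
elim: p u => //= x p IHp u eBC; rewrite /darc eBC ?mem_head //.
congr (_ && (_ && _)).
  by apply: eq_in_all => z zp; rewrite eBC ?mem_head // inE zp orbT.
by apply: IHp => w v z vp zp; apply: eBC; rewrite inE ?vp ?zp orbT.
Qed.

(** * Shifting along a path that starts at an uncovered element *)

Lemma next_tperm y x p : uniq [:: y, x & p] ->
  next [:: y, x & p] =1 tperm y x \o next (x :: p).
Proof.
rewrite /= inE negb_or => /andP[/andP[yx yp] /andP[xp _]] z.
have stp a q : z != y -> z != x -> y \notin q -> x \notin q ->
    next_at z y a q = tperm y x (next_at z x a q).
  move=> zy zx; elim: q a => [|b q IHq] a /=.
    by case: eqP => _; rewrite ?tpermR ?tpermD // eq_sym.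
  rewrite !inE !negb_or => /andP[yb yq] /andP[xb xq].
  by case: eqP => _; [rewrite tpermD|apply: IHq].
have [->|zy] := eqVneq z y.
  rewrite /= eqxx; set n := next_at _ _ _ _; suff -> : n = y by rewrite tpermL.
  rewrite /n; elim: (p) {1 3}x yx yp => [|b q IHq] a /= ya; first by rewrite (negPf ya).
  by rewrite inE negb_or (negPf ya) => /andP[yb yq]; apply: IHq.
rewrite [LHS]/= (negPf zy) /=; case: p yp xp => [|b q] /=.
  by case: eqP => [_|/eqP zx]; rewrite ?tpermR ?tpermD // eq_sym.
rewrite !inE !negb_or => /andP[yb yq] /andP[xb xq].
by case: eqP => [_|/eqP zx]; [rewrite tpermD|apply: stp].
Qed.

(** The first transposition of the cycle is one move; as [y] clashes with no later element,
    [clash_move_in] keeps the rest of the path geodesic. *)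
Lemma path_shift B y p : feasible M B -> ~~ covered B y -> uniq (y :: p) ->
  geodesic B y p -> connect (adjacent M) B (act (next (y :: p)) B).
Proof.
elim: p B y => [|x p IHp] B y fB yB uyp.
  by move=> _; rewrite act_id // => z /=; case: eqP.
case/and3P => e nyp gp; rewrite (eq_act _ (next_tperm uyp)) -act_comp.
have fC := feasible_move fB yB e; apply: connect_trans (connect1 _) _.
  exact: adjacent_move fB yB e.
have /= /andP[] := uyp; rewrite inE negb_or => /andP[yx yp] /andP[xp up].
apply: IHp => //=; [exact: uncovered_move|by rewrite xp|].
rewrite (geodesic_eq (C := B)) // => w v z vp zp.
have px u : u \in p -> u != x by apply: contraTneq => ->.
have py u : u \in p -> u != y by apply: contraTneq => ->.
by apply: clash_move_in; rewrite ?px ?py // (allP nyp).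
Qed.

Lemma next_last x p : uniq (x :: p) -> next (x :: p) (last x p) = x.
Proof.
move=> up; rewrite -(next_rotr 1) // lastI rotr1_rcons.
by case: p {up} => [|y p] /=; rewrite eqxx.
Qed.

(** * Rotating a chordless cycle by single moves *)

Definition chordless B c := uniq c /\ forall w, w \in c -> darc B w (next c w) /\
  forall w', w' \in c -> w' != w -> ~~ clash B w (next c w) (next c w').

Lemma chordless_covered B c w : chordless B c -> w \in c -> covered B w.
Proof.
case=> uc cB wc; have [|/darc_covered + _] := cB (prev c w); first by rewrite mem_prev.
by rewrite next_prev.
Qed.

Lemma chordless_rot B c n : chordless B c -> chordless B (rot n c).
Proof.
case=> uc cB; split=> [|w]; first by rewrite rot_uniq.
rewrite mem_rot => /cB[e nw]; rewrite next_rot //; split => // w'.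
by rewrite mem_rot next_rot //; apply: nw.
Qed.

Lemma next_notin c z : z \notin c -> next c z = z.
Proof. by rewrite next_nth => /negPf->. Qed.

Lemma next_inj c : uniq c -> injective (next c).
Proof. by move=> uc; apply: can_inj (prev_next uc). Qed.

(** Within each [B i], the rotation is the simultaneous exchange of [bases_multi_exch];
    chordlessness supplies its diagonal pattern. *)
Lemma feasible_rotate B c : feasible M B -> chordless B c ->
  feasible M (act (next c) B).
Proof.
move=> fB [uc cB]; have [BM dB] := feasibleP _ fB; apply: feasible_act => // i.
pose W := [set w in c | next c w \in B i].
have eW w : w \in W -> exch (M i) (B i) w (next c w).
  rewrite inE => /andP[/cB[/darcP[j e] _] wi]; have /and3P[_ wj _] := e.
  by rewrite (dB _ _ _ wi wj).
suff -> : next c @^-1: B i = (B i :\: next c @: W) :|: W.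
  apply: bases_multi_exch => //; first by move=> w w' _ _; apply: next_inj.
  move=> w w' wW w'W neq; move: (wW) (w'W); rewrite !inE.
  move=> /andP[wc wi] /andP[w'c w'i]; have [_ /(_ w' w'c neq)] := cB w wc.
  by apply: contra => e; apply/clashP; exists i.
apply/setP => z; rewrite !inE; have [zc|zc] := boolP (z \in c); last first.
  rewrite next_notin // orbF; case: imsetP => //= -[w + zw].
  by rewrite inE => /andP[wc _]; rewrite zw mem_next wc in zc.
case: imsetP => //= nW; have [zi|] := boolP (z \in B i) => //=.
case: nW; exists (prev c z); last by rewrite next_prev.
by rewrite inE mem_prev zc next_prev.
Qed.

(** First [s] takes the place of [x]; then the free place runs from [x] once around the cycle and
    returns to [s], a shift along a path. *)
Lemma rotate_at B c s x : feasible M B -> chordless B c -> ~~ covered B s ->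
  x \in c -> darc B s x -> connect (adjacent M) B (act (next c) B).
Proof.
move=> fB + sB xc e; have [n p rc] := rot_to xc.
move=> /(chordless_rot n) ch; have [ur _] := ch; rewrite rot_uniq in ur.
rewrite -(eq_act _ (next_rot n ur)); rewrite rc in ch *.
have [uc cB] := ch.
have sc : s \notin x :: p by apply: contra sB; apply: chordless_covered.
have usc : uniq [:: s, x & p] by rewrite cons_uniq sc.
have -> : act (next (x :: p)) B = act (next (x :: rcons p s)) (act (tperm s x) B).
  rewrite act_comp; apply: eq_act => z /=.
  rewrite -[next_at z x x (rcons p s)]/(next (x :: rcons p s) z).
  have -> : x :: rcons p s = rot 1 [:: s, x & p] by rewrite rot1_cons.
  by rewrite next_rot // next_tperm // [RHS]tpermK.
apply: connect_trans (connect1 (adjacent_move fB sB e)) _.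
set C := act _ B; apply: path_shift.
- exact: feasible_move.
- exact: uncovered_move.
- by rewrite -rcons_cons rcons_uniq sc.
have np u : u \in x :: p -> u != s by apply: contraTneq => ->.
(* Every suffix of the cycle, closed by [s], is geodesic. The final arc, into [x] in [B], becomes an
   arc into [s]. *)
have suf p1 u p2 : x :: p = p1 ++ u :: p2 -> geodesic C u (rcons p2 s).
  elim: p2 p1 u => [|v p2 IHp] p1 u def_p.
    have uc' : u \in x :: p by rewrite def_p mem_cat mem_head orbT.
    have nu : next (x :: p) u = x.
      have -> : u = last x p by rewrite -[RHS]/(last x (x :: p)) def_p last_cat.
      exact: next_last.
    have [e' _] := cB u uc'; rewrite nu in e'.
    by rewrite /= !andbT darc_move_back ?np.
  have def_p' : x :: p = rcons p1 u ++ v :: p2 by rewrite cat_rcons.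
  have uc' : u \in x :: p by rewrite def_p mem_cat mem_head orbT.
  have vc' : v \in x :: p by rewrite def_p' mem_cat mem_head orbT.
  have nu : next (x :: p) u = v.
    by rewrite -(next_rot (size p1)) // def_p rot_size_cat /= eqxx.
  have [e' nch] := cB u uc'; rewrite nu in e' nch.
  have vx : v != x.
    have xp1 : x \in rcons p1 u.
      by move: def_p'; case: (p1) => [|b q] [<- _]; rewrite mem_head.
    move: uc; rewrite def_p' cat_uniq => /and3P[_ /hasPn/(_ v (mem_head _ _))].
    by move=> /= vp1 _; apply: contraNneq vp1 => ->.
  (* Only the last element of the cycle has successor [x], and [u] is not it. *)
  have nux : ~~ clash B u v x.
    have := nch (prev (x :: p) x); rewrite mem_prev mem_head next_prev //; apply => //.
    by apply: contraNneq vx => pu; rewrite -nu -pu next_prev.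
  have cC z : clash C u v z = clash B u v z by apply: clash_move_out; rewrite ?np.
  rewrite rcons_cons /= {1}/darc cC -/(darc B u v) e' (IHp _ _ def_p') andbT /=.
  apply/allP => z; rewrite mem_rcons inE cC => /predU1P[->|zp].
    by apply: contra sB => /clash_darc/darc_covered.
  have zc' : z \in x :: p by rewrite def_p' mem_cat inE zp !orbT.
  have := nch (prev (x :: p) z); rewrite mem_prev next_prev //; apply => //.
  have: uniq (v :: p2) by move: uc; rewrite def_p' cat_uniq => /and3P[].
  case/andP => vp2 _; apply: contraNneq vp2 => pu.
  by rewrite -nu -pu next_prev.
exact: (suf [::]).
Qed.

Lemma next_tperm_comm c y x : y \notin c -> x \notin c ->
  next c \o tperm y x =1 tperm y x \o next c.
Proof.
move=> yc xc z /=; have [->|/eqP zy] := z =P y; first by rewrite tpermL !next_notin ?tpermL.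
have [->|/eqP zx] := z =P x; first by rewrite tpermR !next_notin ?tpermR.
have [zc|zc] := boolP (z \in c).
  have nN u : u \notin c -> u != next c z by apply: contraNneq => ->; rewrite mem_next.
  by rewrite !tpermD ?nN // eq_sym.
by rewrite (next_notin zc) !tpermD ?next_notin // eq_sym.
Qed.

Lemma path_weaken (e e' : rel T) u p : (forall w z, z \in p -> e w z -> e' w z) ->
  path e u p -> path e' u p.
Proof.
elim: p u => //= z p IHp u ee' /andP[euz ep]; rewrite ee' ?mem_head //=.
by apply: IHp ep => w v vp; apply: ee'; rewrite inE vp orbT.
Qed.

(* If the uncovered elements do not reach the cycle in one step, one step of  *)
(* the path is performed, the cycle is rotated, and the step is undone.        *)
Lemma rotate_connect B c s p : feasible M B -> chordless B c -> ~~ covered B s ->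
  path (darc B) s p -> last s p \in c -> connect (adjacent M) B (act (next c) B).
Proof.
have [n] := ubnP (size p); elim: n B s p => // n IHn B s [|x p] le_n fB ch sB.
  by move=> _ /(chordless_covered ch); rewrite (negPf sB).
case/andP; rewrite -/(path _ _ _) => e pp lc.
have [/hasP[z zc ez]|/hasPn nc] := boolP (has (darc B s) c).
  exact: rotate_at zc ez.
have [/hasP[z zp ez]|/hasPn np] := boolP (has (darc B s) p).
  case/splitPr: zp => p1 p2 in pp lc le_n.
  apply: (IHn B s (z :: p2)) => //=.
  - by move: le_n; rewrite /= size_cat /= ltnS => /(leq_trans _)->; rewrite // ltnS leq_addl.
  - by move: pp; rewrite cat_path /= ez => /and3P[].
  - by move: lc; rewrite /= last_cat.
have xc : x \notin c by apply: contraL e => /nc.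
have sc : s \notin c by apply: contra sB; apply: chordless_covered.
set C := act (tperm s x) B; have fC : feasible M C := feasible_move fB sB e.
have neqx z : ~~ darc B s z -> z != x by apply: contraNneq => ->.
have neqs z : covered B z -> z != s by apply: contraTneq => ->.
(* Both shortcuts failed, so no arc from [s] enters [p] or [c]; the move of [s] thus keeps the arcs
   used by the path and the cycle. *)
have cC w v z : covered B v -> v != x -> covered B z -> ~~ darc B s z ->
    clash C w v z = clash B w v z.
  move=> vB vx zB nsz; apply: clash_move_in => //; [exact: neqs|exact: neqs|exact: neqx|].
  by apply: contra nsz; apply: clash_darc.
have cov := chordless_covered ch.
have [uc cB] := ch; have chC : chordless C c.
  split=> // w wc; have [ew nw] := cB w wc; rewrite -(mem_next c) in wc.
  split=> [|w' w'c /(nw _ w'c)]; first by rewrite /darc cC ?cov ?neqx ?nc.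
  by rewrite -(mem_next c) in w'c; rewrite cC ?cov ?neqx ?nc.
apply: connect_trans (connect1 (adjacent_move fB sB e)) _.
apply: (@connect_trans _ _ (act (next c) C)).
  apply: (IHn _ x p) => //; first exact: uncovered_move.
  apply: path_weaken pp => w z zp ewz; have zB := darc_covered ewz.
  by rewrite /darc cC ?neqx ?np.
(* As [s] and [x] lie off [c], their transposition commutes with the rotation, so undoing the step
   reaches the target. *)
have E : act (next c) B = act (tperm s x) (act (next c) C).
  rewrite !act_comp; apply: eq_act => z /=.
  by have /= <- := next_tperm_comm sc xc (tperm s x z); rewrite tpermK.
have tC : tperm s x = tperm x s by rewrite tpermC.
apply: connect1; rewrite E tC; apply: adjacent_act.
- exact: feasible_rotate.
- by rewrite -tC -E; apply: feasible_rotate.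
- apply: contra (uncovered_move x fB sB) => /coveredP[i].
  by rewrite ffunE inE next_notin // => xi; apply/coveredP; exists i.
have /darcP[i e'] := e; have /and3P[_ xi _] := e'; apply/coveredP; exists i.
by rewrite ffunE inE next_notin // (act_tperm_exch fB sB xi) setU11.
Qed.

Lemma feasible_connect B C : feasible M B -> connect (adjacent M) B C -> feasible M C.
Proof.
move=> fB /connectP[p pp ->]; elim: p B fB pp => //= A p IHp B _ /andP[/and3P[_ fA _]].
exact: IHp.
Qed.

Lemma reconfigurableP B C :
  reconfigurable M B C <-> feasible M B /\ connect (adjacent M) B C.
Proof.
split=> [[fB [p pp ->]]|[fB /connectP[p pp ->]]]; split=> //; last by exists p.
by apply/connectP; exists p.
Qed.

End Sequences.

(** * Coloops of the union: invariance and reachability *)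

Section Coloops.
Variables (T : finType) (k : nat) (M : 'I_k -> matroid T).
Implicit Types (B C : {ffun 'I_k -> {set T}}) (c d : {ffun T -> option 'I_k}).
Implicit Types (R : {set T}) (s x y z : T).

Lemma card_csuppI c R : #|csupp c :&: R| = \sum_i #|cclass c i :&: R|.
Proof.
pose c' : {ffun T -> option 'I_k} := [ffun z => if z \in R then c z else None].
have -> : csupp c :&: R = csupp c'.
  by apply/setP => z; rewrite !inE ffunE; case: (z \in R); rewrite ?andbT ?andbF.
rewrite card_csupp; apply: eq_bigr => i _; apply: eq_card => z.
by rewrite !inE ffunE; case: (z \in R); rewrite ?andbT ?andbF.
Qed.

Definition sequence_coloring B : {ffun T -> option 'I_k} :=
  [ffun z => [pick i | z \in B i]].

Lemma csupp_sequence B z : (z \in csupp (sequence_coloring B)) = covered B z.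
Proof.
rewrite inE ffunE; case: pickP => [i zi|nz].
  by apply/esym/coveredP; exists i.
by apply/esym/coveredP => -[i]; rewrite nz.
Qed.

Lemma cclass_sequence B i : feasible M B -> cclass (sequence_coloring B) i = B i.
Proof.
move=> /feasibleP[_ dB]; apply/setP => z; rewrite inE ffunE.
case: pickP => [j zj|->] //; apply/eqP/idP => [[<-] //|zi].
by rewrite (dB _ _ _ zi zj).
Qed.

Lemma cindep_sequence B : feasible M B -> cindep M (sequence_coloring B).
Proof.
move=> fB i; exists (B i); last by rewrite cclass_sequence.
by case/feasibleP: fB.
Qed.

(** Each colour class is at most as large as a basis of its matroid, so no independent set of the
    union is larger. *)
Lemma union_bases_sequence B : feasible M B ->
  csupp (sequence_coloring B) \in union_bases M.
Proof.
move=> fB; have [X XM sX] := coloring_max (cindep_sequence fB).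
suff <- : X = csupp (sequence_coloring B) by [].
have [d dI dX] := union_bases_coloring XM.
apply/esym/eqP; rewrite eqEcard sX -dX !card_csupp; apply: leq_sum => i _.
have [D DM sD] := dI i; rewrite cclass_sequence // (leq_trans (subset_leq_card sD)) //.
by case/feasibleP: fB => BM _; rewrite (card_bases DM (BM i)).
Qed.

(* The set [R] of elements reachable from the uncovered ones is spanned in   *)
(* each [M i] by [B i :&: R], so a union basis has at most as many elements   *)
(* inside [R] as the union of the [B i]: it must contain all those outside.   *)
Lemma reach_noncoloop B x : feasible M B -> covered B x ->
  x \notin coloops (matroid_union M) ->
  exists2 s, ~~ covered B s & connect (darc M B) s x.
Proof.
move=> fB xB; have [BM dB] := feasibleP _ _ fB.
pose R := [set z | [exists s, ~~ covered B s && connect (darc M B) s z]].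
have [|xR] := boolP (x \in R).
  by rewrite inE => /existsP[s /andP[]]; exists s.
case/negP; rewrite inE; apply/andP; split.
  case/coveredP: xB => i xi; apply/bigcupP; exists i => //.
  exact: (subsetP (bases_ground (BM i))).
apply/forall_inP => D DM; apply: contraT => xD.
have [d dI dD] := union_bases_coloring DM.
have UB := union_bases_sequence fB; set c := sequence_coloring B in UB.
have := card_bases (M := matroid_union M) DM UB.
rewrite -(cardsID R D) -(cardsID R (csupp c)) => /eqP; apply: contraTT => _.
rewrite neq_ltn; apply/orP; left; rewrite -addnS; apply: leq_add.
  rewrite -dD !card_csuppI; apply: leq_sum => i _; rewrite cclass_sequence //.
  rewrite leqNgt; apply/negP => lt.
  have [D' D'M sD'] := dI i.
  have [||w] := bases_augment (BM i) D'M _ _ lt.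
  - exact: subsetIl.
  - by apply: subset_trans sD'; apply: subsetIl.
  rewrite !inE => /andP[wBR /andP[_ wR]] [D'' D''M sD''].
  have wB : w \notin B i by rewrite wR andbT in wBR.
  (* This gives an arc from [w] in [R] to some [z] outside [R], against the closure of [R] under
     arcs. *)
  have [|z] := exch_avoid (BM i) D''M wB _ sD''; first exact: subsetIl.
  rewrite !inE => /andP[+ zB] e; rewrite zB /= => /negP[].
  case/existsP: wR => s /andP[sB sw]; apply/existsP; exists s; rewrite sB /=.
  by apply: connect_trans sw (connect1 _); apply/darcP; exists i.
apply: proper_card; apply/properP; split.
  apply/subsetP => z; rewrite !inE => /andP[zR _]; rewrite zR /=.
  have := csupp_sequence B z; rewrite -/c inE => ->.
  by apply: contraR zR => zB; apply/existsP; exists z; rewrite zB connect0.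
by exists x; rewrite in_setD xR ?csupp_sequence.
Qed.

(** The inserted element would be covered twice afterwards if it were a coloop, and the removed one
    would no longer be covered. *)
Lemma adjacent_coloops B C i : adjacent M B C ->
  coloops (matroid_union M) :&: B i = coloops (matroid_union M) :&: C i.
Proof.
have sub B1 z : feasible M B1 -> z \in coloops (matroid_union M) -> covered B1 z.
  move=> fB1; rewrite inE => /andP[_ /forall_inP/(_ _ (union_bases_sequence fB1))].
  by rewrite csupp_sequence.
case/and3P=> fB fC /existsP[j /andP[/forall_inP BC /exists_inP[x xj]]].
case/exists_inP => y /setDP[_ yj] /eqP Cj.
have [_ dB] := feasibleP _ _ fB; have [_ dC] := feasibleP _ _ fC.
have [->|ij] := eqVneq i j; last by rewrite (eqP (BC i ij)).
apply/setP => z; rewrite !in_setI; apply: andb_id2l => zK; rewrite Cj !inE.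
have [zy|zy] := eqVneq z y.
  have /coveredP[l zl] := sub _ _ fB zK.
  have lj : l != j by apply: contraNneq yj => <-; rewrite -zy.
  have zCl : z \in C l by rewrite -(eqP (BC l lj)).
  have zCj : z \in C j by rewrite Cj zy setU11.
  by rewrite (dC _ _ _ zCl zCj) eqxx in lj.
have [zx|//] := eqVneq z x; rewrite -zx in xj.
have /coveredP[l zl] := sub _ _ fC zK.
have [lj|lj] := eqVneq l j.
  by move: zl; rewrite lj Cj !inE zx eqxx orbF -zx (negPf zy).
by rewrite -(eqP (BC l lj)) in zl; rewrite (dB _ _ _ zl xj) eqxx in lj.
Qed.

Lemma connect_coloops B C i : connect (adjacent M) B C ->
  coloops (matroid_union M) :&: B i = coloops (matroid_union M) :&: C i.
Proof.
case/connectP => p pp ->; elim: p B pp => //= A p IHp B /andP[/adjacent_coloops-> pp].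
exact: IHp.
Qed.

End Coloops.

(** * Closed walks in a finite relation *)

(** Iterating a choice of predecessor eventually loops; the loop read backwards is the closed
    walk. *)
Lemma serial_cycle (T : finType) (e : rel T) (V : {set T}) : V != set0 ->
  {in V, forall z, exists2 w, w \in V & e w z} ->
  exists2 c, c != [::] & cycle e c.
Proof.
case/set0Pn => x xV pV.
pose f z := odflt z [pick w in V | e w z].
have fP z : z \in V -> f z \in V /\ e (f z) z.
  move=> zV; rewrite /f; case: pickP => [w /andP[] //|nw].
  by have [w wV ew] := pV z zV; have := nw w; rewrite wV ew.
have iV j : iter j f x \in V by elim: j => //= j /fP[].
have /trajectP[j lt_j def_x] := looping_order f x.
pose y := iter j f x; pose n := order f x - j.
have n_gt0 : 0 < n by rewrite subn_gt0.
have yn : iter n f y = y by rewrite /y -iterD subnK ?(ltnW lt_j) // def_x.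
exists (rev (traject f y n)).
  by rewrite -size_eq0 size_rev size_traject -lt0n.
rewrite rev_cycle; case: (n) n_gt0 yn => // m _ yn.
rewrite trajectS /=.
have: path (frel f) y (rcons (traject f (f y) m) y).
  have := fpath_traject f y m.+1; rewrite trajectSr -iterSr yn //.
have : y \in V by apply: iV.
move: (rcons _ y) => q; elim: q (y) => //= z p IHp u uV /andP[/eqP <- pp].
by have [fV ->] := fP u uV; apply: IHp.
Qed.

(* In a shortest closed walk the only arc into the successor of [w'] comes    *)
(* from [w'], as any other one would close a strictly shorter walk.           *)
Lemma induced_cycle (T : finType) (e : rel T) c0 : c0 != [::] -> cycle e c0 ->
  exists c, [/\ c != [::], uniq c, cycle e c &
    {in c &, forall w w', e w (next c w') -> w = w'}].
Proof.
have [n] := ubnP (size c0); elim: n c0 => // n IHn c0 le_n c0n ec0.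
have [|/existsPn min_c] := boolP [exists m : 'I_(size c0),
    [exists t : m.-tuple T, (0 < m) && cycle e t]].
  case/existsP => m /existsP[t /andP[m_gt0 et]]; apply: (IHn t) => //.
    by rewrite size_tuple (leq_trans (ltn_ord m)).
  by rewrite -size_eq0 size_tuple -lt0n.
(* An arc back to the start closes a prefix of the walk, which by minimality is the whole walk. *)
have close i x p1 p2 : rot i c0 = x :: p1 ++ p2 -> e (last x p1) x -> p2 = [::].
  move=> rc ex; apply: contraTeq (ec0) => p2n.
  have lt_p1 : (size p1).+1 < size c0.
    by rewrite -(size_rot i c0) rc /= size_cat ltnS -addn1 leq_add2l lt0n size_eq0.
  have := min_c (Ordinal lt_p1); apply: contraNN => _.
  have := ec0; rewrite -(rot_cycle i) rc /= rcons_cat cat_path => /andP[pp1 _].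
  by apply/existsP; exists (in_tuple (x :: p1)); rewrite /= rcons_path pp1.
have uc0 : uniq c0.
  apply: count_mem_uniq => x; case: (boolP (x \in c0)) => [xc|/count_memPn //].
  have [i p rc] := rot_to xc.
  have: cycle e (x :: p) by rewrite -rc rot_cycle.
  have /seq.permP/(_ (pred1 x))-> : perm_eq c0 (x :: p) by rewrite -rc perm_sym perm_rot.
  rewrite /= eqxx; have [xp ecp|/count_memPn-> //] := boolP (x \in p).
  case/splitPr: xp rc ecp => p1 p2 rc ecp.
  suff : x :: p2 = [::] by [].
  apply: (close i x p1) => //.
  by move: ecp; rewrite /= rcons_cat cat_path => /and3P[].
exists c0; split=> // w w' wc w'c ew.
have [i [p rc]] : exists i p, rot i c0 = next c0 w' :: p.
  by have [|i p rc] := @rot_to _ c0 (next c0 w'); [rewrite mem_next|exists i, p].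
have up : uniq (next c0 w' :: p) by rewrite -rc rot_uniq.
have wp : w \in next c0 w' :: p by rewrite -rc mem_rot.
apply: (next_inj uc0); rewrite -[LHS](next_rot i) // rc.
case/splitPl: wp rc up => p1 p2 lw rc up.
have p2_nil : p2 = [::] by apply: close rc _; rewrite lw.
by rewrite p2_nil cats0 in up *; rewrite -lw next_last.
Qed.

(** * Descent towards the target sequence *)

Section Main.
Variables (T : finType) (k : nat) (M : 'I_k -> matroid T).
Implicit Types (B C D : {ffun 'I_k -> {set T}}).

Definition seq_dist B C := \sum_i #|B i :\: C i|.

Lemma seq_dist_lt B C D : (forall i, C i :\: D i \subset B i :\: D i) ->
  (exists i, C i :\: D i \proper B i :\: D i) -> seq_dist C D < seq_dist B D.
Proof.
move=> sCB [i pCB]; rewrite /seq_dist (bigD1 i) //= [X in _ < X](bigD1 i) //= -addSn.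
by rewrite leq_add ?proper_card // leq_sum // => j _; apply: subset_leq_card.
Qed.

(** By [exch_avoid] with the common part of [B i] and [D i], the element that [s] replaces can be
    chosen outside [D i]. *)
Lemma closer_of_uncovered B D s : feasible M B -> feasible M D ->
  ~~ covered B s -> covered D s ->
  exists2 C, connect (adjacent M) B C & seq_dist C D < seq_dist B D.
Proof.
move=> fB fD sB /coveredP[i si].
have [BM _] := feasibleP _ _ fB; have [DM _] := feasibleP _ _ fD.
have sBi : s \notin B i by apply: contra sB => sBi; apply/coveredP; exists i.
have [||x] := exch_avoid (I := B i :&: D i) (BM i) (DM i) sBi; first exact: subsetIl.
  by rewrite subUset sub1set si subsetIr.
rewrite !inE => /andP[+ xi]; rewrite xi /= => xD e.
have es : darc M B s x by apply/darcP; exists i.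
exists (act (tperm s x) B); first exact: connect1 (adjacent_move fB sB es).
have Ci := act_tperm_exch fB sB xi.
have sub : act (tperm s x) B i :\: D i \proper B i :\: D i.
  rewrite Ci; apply/properP; split.
    apply/subsetP => z; rewrite !inE => /andP[zD]; rewrite zD /=.
    by case/orP => [/eqP zs|/andP[]] //; rewrite zs si in zD.
  exists x; rewrite !inE ?xD ?xi // eqxx /= orbF.
  by apply: contraNneq sBi => <-.
apply: seq_dist_lt => [j|]; last by exists i.
have [->|ji] := eqVneq j i; first exact: proper_sub.
by rewrite (act_tperm_other fB sB xi ji).
Qed.

(** A misplaced [z] in [B i] can be replaced by some [w] of [D i]; [w] is covered by another [B j],
    hence is misplaced there too. So every misplaced element has a misplaced predecessor, and a
    cycle arises. *)
Lemma closer_of_covered B D : feasible M B -> feasible M D ->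
  (forall z, covered D z -> covered B z) -> B != D ->
  (forall i, coloops (matroid_union M) :&: B i = coloops (matroid_union M) :&: D i) ->
  exists2 C, connect (adjacent M) B C & seq_dist C D < seq_dist B D.
Proof.
move=> fB fD sDB neBD eqK.
have [BM dB] := feasibleP _ _ fB; have [DM dD] := feasibleP _ _ fD.
pose e w z := [exists i, [&& w \in D i, z \notin D i & exch (M i) (B i) w z]].
pose V := [set z | [exists i, z \in B i :\: D i]].
have V_neq0 : V != set0.
  apply: contraNneq neBD => V0; apply/eqP/ffunP => i.
  apply: (bases_sub_eq (BM i) (DM i)); apply/subsetP => z zi; apply: contraT => zD.
  by have := in_set0 z; rewrite -V0 inE => /existsP[]; exists i; rewrite inE zD.
have [|c0 c0n ec0] := serial_cycle (e := e) V_neq0.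
  move=> z; rewrite inE => /existsP[i zi].
  have [w] := bases_exchange (BM i) (DM i) zi; rewrite inE => /andP[wB wD] BM'.
  have /setDP[ziB ziD] := zi; exists w; last first.
    by apply/existsP; exists i; rewrite wD ziD /exch wB ziB.
  have /coveredP[j wj] : covered B w by apply/sDB/coveredP; exists i.
  rewrite inE; apply/existsP; exists j; rewrite inE wj andbT.
  by apply: contra wB => wDj; rewrite (dD _ _ _ wD wDj).
have [c [cn uc ec min_c]] := induced_cycle c0n ec0.
have eP w : w \in c -> exists i, [/\ w \in D i, next c w \notin D i
    & exch (M i) (B i) w (next c w)].
  by move=> wc; have /existsP[i /and3P[]] := next_cycle ec wc; exists i.
have ch : chordless M B c.
  split=> // w wc; have [i [wD _ ew]] := eP w wc.
  split=> [|w' w'c]; first by apply/darcP; exists i.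
  apply: contraNN => /clashP[j nj e'].
  have ij : i = j by apply: (dB _ _ _ _ nj); case/and3P: ew.
  rewrite -ij in e'; apply/eqP/esym/min_c => //; apply/existsP; exists i.
  rewrite wD e' andbT; have [l [_ nD /and3P[_ nl _]]] := eP w' w'c.
  by rewrite (dB i l (next c w')) //; case/and3P: e'.
have [x xc] : exists x, x \in c by case: (c) cn => // x p _; exists x; rewrite mem_head.
have [i [_ yD /and3P[_ yi _]]] := eP x xc; rewrite -(mem_next c) in xc.
move: (next c x) yD yi xc => y yD yi yc {x}.
(* The rotation puts every element of [c] into the set where [D] has it. *)
have sub j z : z \in act (next c) B j -> z \notin D j -> z \notin c.
  rewrite ffunE inE => nz zD; apply: contra zD => /eP[l [zD _ /and3P[_ nl _]]].
  by rewrite (dB _ _ _ nz nl).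
(* [y] lies in [B i] but not in [D i], so agreement on the coloops excludes that it is one. *)
have [||s sB /connectP[p pp yp]] := reach_noncoloop (x := y) fB.
- by apply/coveredP; exists i.
- apply: contra yD => yK.
  by have := in_setI y (coloops (matroid_union M)) (D i); rewrite -eqK inE yK yi.
exists (act (next c) B); first by apply: rotate_connect pp _; rewrite -?yp.
apply: seq_dist_lt => [j|].
  apply/subsetP => z /setDP[zj zD]; have zc := sub j z zj zD.
  by rewrite ffunE inE next_notin // in zj; rewrite inE zD.
exists i; apply/properP; split.
  apply/subsetP => z /setDP[zj zD]; have zc := sub i z zj zD.
  by rewrite ffunE inE next_notin // in zj; rewrite inE zD.
exists y; first by rewrite inE yD.
by apply/negP => /setDP[/sub/(_ yD)/negP].
Qed.

Lemma connect_of_coloops B D : feasible M B -> feasible M D ->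
  (forall i, coloops (matroid_union M) :&: B i = coloops (matroid_union M) :&: D i) ->
  connect (adjacent M) B D.
Proof.
have [n] := ubnP (seq_dist B D); elim: n B => // n IHn B le_n fB fD eqK.
have [->|neBD] := eqVneq B D; first exact: connect0.
suff [C BC lt_C] :
    exists2 C, connect (adjacent M) B C & seq_dist C D < seq_dist B D.
  apply: (connect_trans BC); apply: IHn => //; first exact: leq_trans lt_C _.
    exact: feasible_connect fB BC.
  by move=> i; rewrite -eqK -(connect_coloops _ BC).
have [/existsP[s /andP[sD sB]]|nB] := boolP [exists s, covered D s && ~~ covered B s].
  exact: closer_of_uncovered sB sD.
apply: closer_of_covered => // z zD; apply: contraR nB => zB.
by apply/existsP; exists z; rewrite zD.
Qed.

End Main.

Theorem theorem3 (T : finType) (k : nat) (M : 'I_k -> matroid T)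
    (B B' : {ffun 'I_k -> {set T}}) (hB : feasible M B) (hB' : feasible M B') :
  reconfigurable M B B' <->
  [ffun i => coloops (matroid_union M) :&: B i] =
  [ffun i => coloops (matroid_union M) :&: B' i].
Proof.
split=> [/reconfigurableP[_ BB']|/ffunP eqK].
  by apply/ffunP => i; rewrite !ffunE; apply: connect_coloops.
apply/reconfigurableP; split=> //; apply: connect_of_coloops => // i.
by have := eqK i; rewrite !ffunE.
Qed.
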